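(* For every positive integer $r$, the identity $$\sum_{k=1}^{\infty}\binom{rk}{k}\frac{x^k}{k}=r\log(\mathcal{B}_r(x))$$ holds in the formal power series ring $\mathbb{Q}[[x]]$.
   Context: For a positive integer $r$, $\mathcal{B}_r(x)\in\mathbb{Q}[[x]]$ denotes the power series $$\mathcal{B}_r(x)=\sum_{k=0}^{\infty}\frac{1}{rk+1}\binom{rk+1}{k}x^k=\sum_{k=0}^{\infty}\frac{1}{(r-1)k+1}\binom{rk}{k}x^k ,$$ which has constant term $1$. For a power series $f$ with constant term $1$, $\log(f)=-\sum_{k\ge 1}(1-f)^k/k$. *)

(* Defs.v *)
From HB Require Import structures.
From mathcomp Require Import all_boot all_order all_algebra.
From mathcomp Require Import boolp classical_sets.
Set Implicit Arguments.
Unset Strict Implicit.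
Unset Printing Implicit Defensive.
Import Order.TTheory GRing.Theory Num.Theory.
Local Open Scope ring_scope.

(* R[[x]].  A record rather than an alias of nat -> R, so that the pointwise
   ring structure on functions is never inferred for it. *)
Record fps (R : Type) := Fps { fcoef : nat -> R }.

HB.instance Definition _ (R : Type) := [isNew for @fcoef R].
HB.instance Definition _ (R : choiceType) := [Choice of fps R by <:].

Lemma fpsP (R : Type) (f g : fps R) :
  (forall n, fcoef f n = fcoef g n) <-> f = g.
Proof.
split=> [fg|-> //]; case: f g fg => [f] [g] /= fg.
by congr Fps; apply/funext.
Qed.

Section FpsRing.
Variable R : comNzRingType.
Implicit Types f g h : fps R.

Definition fps_zero : fps R := Fps (fun=> 0).
Definition fps_opp f := Fps (fun n => - fcoef f n).
Definition fps_add f g := Fps (fun n => fcoef f n + fcoef g n).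

Fact fps_addA : associative fps_add.
Proof. by move=> f g h; apply/fpsP => n /=; rewrite addrA. Qed.
Fact fps_addC : commutative fps_add.
Proof. by move=> f g; apply/fpsP => n /=; rewrite addrC. Qed.
Fact fps_add0 : left_id fps_zero fps_add.
Proof. by move=> f; apply/fpsP => n /=; rewrite add0r. Qed.
Fact fps_addN : left_inverse fps_zero fps_opp fps_add.
Proof. by move=> f; apply/fpsP => n /=; rewrite addNr. Qed.

HB.instance Definition _ := GRing.isZmodule.Build (fps R)
  fps_addA fps_addC fps_add0 fps_addN.

Definition fps_one : fps R := Fps (fun n => (n == 0%N)%:R).
Definition fps_mul f g : fps R :=
  Fps (fun n => \sum_(i < n.+1) fcoef f i * fcoef g (n - i)).

Let trunc N f : {poly R} := \poly_(i < N) fcoef f i.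

Let coef_trunc N f i : (i < N)%N -> (trunc N f)`_i = fcoef f i.
Proof. by move=> iN; rewrite coef_poly iN. Qed.

Let coef_truncM N f g n : (n < N)%N ->
  (trunc N f * trunc N g)`_n = fcoef (fps_mul f g) n.
Proof.
move=> nN; rewrite coefM; apply: eq_bigr => i _.
rewrite !coef_trunc //; first exact: leq_ltn_trans (leq_subr _ _) nN.
by apply: leq_ltn_trans nN; rewrite -ltnS.
Qed.

Fact fps_mulC : commutative fps_mul.
Proof.
by move=> f g; apply/fpsP => n; rewrite -!(@coef_truncM n.+1) // mulrC.
Qed.

Fact fps_mulA : associative fps_mul.
Proof.
move=> f g h; apply/fpsP => n.
transitivity ((trunc n.+1 f * (trunc n.+1 g * trunc n.+1 h))`_n).
  rewrite coefM; apply: eq_bigr => i _.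
  by rewrite coef_trunc // coef_truncM // ltnS leq_subr.
rewrite mulrA coefM; apply: eq_bigr => i _.
by rewrite coef_truncM // coef_trunc // ltnS leq_subr.
Qed.

Fact fps_mul1 : left_id fps_one fps_mul.
Proof.
move=> f; apply/fpsP => n /=; rewrite big_ord_recl /= subn0 mul1r.
by rewrite big1 ?addr0 // => i _; rewrite mul0r.
Qed.

Fact fps_mulDl : left_distributive fps_mul fps_add.
Proof.
move=> f g h; apply/fpsP => n /=; rewrite -big_split /=.
by apply: eq_bigr => i _; rewrite mulrDl.
Qed.

Fact fps_oner_neq0 : fps_one != 0.
Proof.
by apply/eqP => /(congr1 (@fcoef R ^~ 0%N)) /eqP; rewrite /= oner_eq0.
Qed.

HB.instance Definition _ := GRing.Zmodule_isComNzRing.Build (fps R)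
  fps_mulA fps_mulC fps_mul1 fps_mulDl fps_oner_neq0.

Definition fps_scale (a : R) f := Fps (fun n => a * fcoef f n).

Fact fps_scaleA a b f : fps_scale a (fps_scale b f) = fps_scale (a * b) f.
Proof. by apply/fpsP => n /=; rewrite mulrA. Qed.
Fact fps_scale1 : left_id 1 fps_scale.
Proof. by move=> f; apply/fpsP => n /=; rewrite mul1r. Qed.
Fact fps_scaleDr : right_distributive fps_scale +%R.
Proof. by move=> a f g; apply/fpsP => n /=; rewrite mulrDr. Qed.
Fact fps_scaleDl f : {morph fps_scale^~ f : a b / a + b}.
Proof. by move=> a b; apply/fpsP => n /=; rewrite mulrDl. Qed.

HB.instance Definition _ := GRing.Zmodule_isLmodule.Build R (fps R)
  fps_scaleA fps_scale1 fps_scaleDr fps_scaleDl.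

Fact fps_scaleAl (a : R) (f g : fps R) : a *: (f * g) = a *: f * g.
Proof.
apply/fpsP => n /=; rewrite mulr_sumr.
by apply: eq_bigr => i _; rewrite mulrA.
Qed.

HB.instance Definition _ := GRing.Lmodule_isLalgebra.Build R (fps R)
  fps_scaleAl.
HB.instance Definition _ := GRing.Lalgebra_isComAlgebra.Build R (fps R).

Definition fpsX : fps R := Fps (fun n => (n == 1%N)%:R).

Lemma fcoef0 n : fcoef (0 : fps R) n = 0.
Proof. by []. Qed.
Lemma fcoef1 n : fcoef (1 : fps R) n = (n == 0%N)%:R.
Proof. by []. Qed.
Lemma fcoefD f g n : fcoef (f + g) n = fcoef f n + fcoef g n.
Proof. by []. Qed.
Lemma fcoefN f n : fcoef (- f) n = - fcoef f n.
Proof. by []. Qed.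
Lemma fcoefB f g n : fcoef (f - g) n = fcoef f n - fcoef g n.
Proof. by []. Qed.
Lemma fcoefZ a f n : fcoef (a *: f) n = a * fcoef f n.
Proof. by []. Qed.
Lemma fcoefM f g n :
  fcoef (f * g) n = \sum_(i < n.+1) fcoef f i * fcoef g (n - i).
Proof. by []. Qed.

Lemma fcoef_sum (I : Type) (s : seq I) (P : pred I) (F : I -> fps R) n :
  fcoef (\sum_(i <- s | P i) F i) n = \sum_(i <- s | P i) fcoef (F i) n.
Proof. exact: (big_morph (fun f => fcoef f n) (fun f g => fcoefD f g n)). Qed.

Lemma fcoefXM f n : fcoef (fpsX * f) n = if n is m.+1 then fcoef f m else 0.
Proof.
rewrite fcoefM big_ord_recl /= mul0r add0r; case: n => [|n].
  by rewrite big_ord0.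
rewrite big_ord_recl /= mul1r subSS subn0 big1 ?addr0 // => i _.
by rewrite mul0r.
Qed.

Lemma fcoefXn k n : fcoef (fpsX ^+ k) n = (n == k)%:R.
Proof.
elim: k n => [|k IHk] n; first by rewrite expr0.
by rewrite exprS fcoefXM; case: n => [|n] //; rewrite IHk.
Qed.

Lemma fcoef_expr_small f k n :
  fcoef f 0 = 0 -> (n < k)%N -> fcoef (f ^+ k) n = 0.
Proof.
move=> f0; elim: k n => // k IHk n nk.
rewrite exprS fcoefM big_ord_recl f0 mul0r add0r big1 // => i _ /=.
rewrite IHk ?mulr0 //; apply: leq_trans (nk : (n <= k)%N).
by rewrite ltn_subrL /= (leq_ltn_trans (leq0n i) (ltn_ord i)).
Qed.

(* Convergence of the partial sums to s in the x-adic topology: every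
   coefficient is eventually constant. *)
Definition fps_has_sum (m : nat) (u : nat -> fps R) (s : fps R) : Prop :=
  forall n, exists N, forall M, (N <= M)%N ->
    fcoef (\sum_(m <= k < M) u k) n = fcoef s n.

(* The junk value 0 is taken when the series diverges. *)
Definition fps_sum (m : nat) (u : nat -> fps R) : fps R :=
  xget 0 [set s | fps_has_sum m u s]%classic.

Lemma fps_has_sum_uniq m u s t :
  fps_has_sum m u s -> fps_has_sum m u t -> s = t.
Proof.
move=> us ut; apply/fpsP => n; have [N hN] := us n; have [N' hN'] := ut n.
by rewrite -(hN (maxn N N')) ?leq_maxl // hN' ?leq_maxr.
Qed.

Lemma fps_sumE m u s : fps_has_sum m u s -> fps_sum m u = s.
Proof.
move=> us; apply: (@fps_has_sum_uniq m u) => //.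
by rewrite /fps_sum; case: xgetP => // /(_ s).
Qed.

Lemma fps_has_sum_small m u :
  (forall k n, (n < k)%N -> fcoef (u k) n = 0) ->
  fps_has_sum m u (Fps (fun n => \sum_(m <= k < n.+1) fcoef (u k) n)).
Proof.
move=> u0 n; exists (maxn m n.+1) => M; rewrite geq_max => /andP[mM nM].
rewrite fcoef_sum /=; case: (leqP m n.+1) => [mn|nm].
  rewrite (big_cat_nat mn nM) /= [X in _ + X]big1_seq ?addr0 // => k.
  by rewrite mem_index_iota => /andP[_ /andP[nk _]]; rewrite u0.
rewrite [RHS]big_geq ?(ltnW nm) // big1_seq // => k.
rewrite mem_index_iota => /andP[_ /andP[mk _]].
by rewrite u0 // (leq_trans _ mk) // ltnW.
Qed.

Lemma fcoef_fps_sum m u n :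
  (forall k n, (n < k)%N -> fcoef (u k) n = 0) ->
  fcoef (fps_sum m u) n = \sum_(m <= k < n.+1) fcoef (u k) n.
Proof. by move=> /fps_has_sum_small /fps_sumE ->. Qed.

Lemma fcoef_fps_sumX m (a : nat -> R) n :
  fcoef (fps_sum m (fun k => a k *: fpsX ^+ k)) n = if (m <= n)%N then a n else 0.
Proof.
rewrite fcoef_fps_sum => [|k i ik]; last first.
  by rewrite fcoefZ fcoefXn (ltn_eqF ik) mulr0.
case: leqP => mn; last by rewrite big_geq.
rewrite big_nat_recr //= fcoefXn eqxx mulr1 big1_seq ?add0r // => k.
rewrite mem_index_iota => /andP[_ /andP[_ kn]].
by rewrite fcoefXn gtn_eqF ?mulr0.
Qed.

End FpsRing.

Arguments fpsX {R}.

Notation "\fsum_ ( m <= k ) F" := (fps_sum m (fun k : nat => F))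
  (at level 41, F at level 41, m at level 69, k name,
   format "'[' \fsum_ ( m  <=  k ) '/  '  F ']'") : ring_scope.

(* Meaningful for fcoef f 0 = 1, which makes the series converge. *)
Definition fps_log (f : fps rat) : fps rat :=
  - \fsum_(1 <= k) (k%:R^-1 *: (1 - f) ^+ k).

Lemma fcoef_fps_log (f : fps rat) n : fcoef f 0 = 1 ->
  fcoef (fps_log f) n =
  - \sum_(1 <= k < n.+1) k%:R^-1 * fcoef ((1 - f) ^+ k) n.
Proof.
move=> f0; rewrite fcoefN fcoef_fps_sum // => k i ik.
by rewrite fcoefZ fcoef_expr_small ?mulr0 // fcoefB f0 subrr.
Qed.

Definition binomial_series (r : nat) : fps rat :=
  \fsum_(0 <= k) (('C(r * k + 1, k)%:R / (r * k + 1)%:R) *: fpsX ^+ k).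

Lemma binomial_series_coef0 r : fcoef (binomial_series r) 0 = 1.
Proof. by rewrite fcoef_fps_sumX /= muln0 bin0 divr1. Qed.

Lemma binomial_seriesE r : (0 < r)%N ->
  binomial_series r =
  \fsum_(0 <= k) (('C(r * k, k)%:R / ((r - 1) * k + 1)%:R) *: fpsX ^+ k).
Proof.
move=> r0; apply/fpsP => n; rewrite !fcoef_fps_sumX /=.
have nz m : (m + 1)%:R != 0 :> rat by rewrite pnatr_eq0 addn1.
apply/eqP; rewrite eqr_div // -!natrM eqr_nat; apply/eqP.
rewrite mulnC [RHS]mulnC !addn1 mul_bin_down.
by rewrite subSn ?leq_pmull // mulnBl mul1n.
Qed.

(* Main.v *)
Require Import Defs.
From mathcomp Require Import all_boot all_order all_algebra.
Import GRing.Theory.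
Local Open Scope ring_scope.

(** Apply the Euler operator theta = x d/dx.  It kills only constants, it turns
    the left-hand side into S_0 - 1, where S_a is the series of the
    binomials C(a + r n, n), and it turns log B into theta B / B
    ([fps_eulerD_log]).  Cancelling the invertible series B, the theorem amounts
    to B (S_0 - 1) = r theta B.

    Since (r n + 1) times the n-th coefficient of B is C(r n + 1, n), one has
    B + r theta B = S_1, so what remains is the convolution B S_0 = S_1, an
    instance of the Rothe-Hagen identity.  It is proved for all powers of B
    at once.  Pascal's rule says that a |-> S_a solves the recurrence
      F_(a+1) = F_a + x F_(a+r),
    whose solutions are determined by F_0, because each step to the right costs
    a factor x ([pascal_rec_uniq]).  The series P_a = S_a - r x S_(a+r-1) solves
    it too, being a combination of shifts of S, and it satisfies P_0 = 1 and
    P_1 = B (in fact P_a = B^a).  Hence a |-> P_a S_0 and a |-> S_a are solutions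
    with the same initial value, so they agree, and a = 1 is the convolution. *)

Section Euler.
Variable R : comNzRingType.
Implicit Types f g : fps R.

Definition fps_eulerD f : fps R := Fps (fun n => n%:R * fcoef f n).

Lemma fcoef_eulerD f n : fcoef (fps_eulerD f) n = n%:R * fcoef f n.
Proof. by []. Qed.

Lemma fps_eulerDN f : fps_eulerD (- f) = - fps_eulerD f.
Proof. by apply/fpsP => n; rewrite /= mulrN. Qed.

Lemma fps_eulerDD f g : fps_eulerD (f + g) = fps_eulerD f + fps_eulerD g.
Proof. by apply/fpsP => n; rewrite /= mulrDr. Qed.

Lemma fps_eulerDZ a f : fps_eulerD (a *: f) = a *: fps_eulerD f.
Proof. by apply/fpsP => n; rewrite /= mulrCA. Qed.

Lemma fps_eulerD1 : fps_eulerD 1 = 0.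
Proof. by apply/fpsP => -[|n]; rewrite /= ?mul0r ?mulr0. Qed.

Lemma fps_eulerD_sum (I : Type) (s : seq I) (F : I -> fps R) :
  fps_eulerD (\sum_(i <- s) F i) = \sum_(i <- s) fps_eulerD (F i).
Proof.
apply: (big_morph fps_eulerD fps_eulerDD).
by apply/fpsP => n; rewrite /= mulr0.
Qed.

Lemma fps_eulerDM f g :
  fps_eulerD (f * g) = fps_eulerD f * g + f * fps_eulerD g.
Proof.
apply/fpsP => n; rewrite fcoefD /= mulr_sumr -big_split; apply: eq_bigr => i _ /=.
have iN : (i <= n)%N by rewrite -ltnS.
by rewrite -{1}(subnKC iN) natrD mulrDl mulrA; congr (_ + _); rewrite mulrCA.
Qed.

Lemma fps_eulerDX f k :
  fps_eulerD (f ^+ k.+1) = k.+1%:R *: (f ^+ k * fps_eulerD f).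
Proof.
elim: k => [|k IHk]; first by rewrite expr1 expr0 mul1r scale1r.
rewrite exprS fps_eulerDM IHk -scalerAr mulrA -exprS mulrC.
by rewrite -[in RHS]add1n natrD scalerDl scale1r.
Qed.

Lemma fps_mulI f g h : fcoef f 0 = 1 -> f * g = f * h -> g = h.
Proof.
move=> f0 fgh; apply/fpsP => n; elim/ltn_ind: n => n IHn.
move/(congr1 (fun s => fcoef s n)): fgh; rewrite !fcoefM !big_ord_recl f0 !mul1r.
rewrite !subn0 [X in _ = _ + X -> _](eq_bigr
  (fun i : 'I_n => fcoef f (lift ord0 i) * fcoef g (n - lift ord0 i))).
  by move/addIr.
by move=> i _; rewrite IHn // ltn_subrL (leq_ltn_trans _ (ltn_ord i)).
Qed.

End Euler.

Arguments fps_eulerD {R} f.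

(** The Euler operator sends the partial sum of order N of - log f, with
    u = 1 - f, to the geometric sum (1 + u + ... + u^(N-1)) theta u, so that
    multiplying by f = 1 - u telescopes up to the term u^N theta u of order at
    least N. *)
Lemma fps_eulerD_log (f : fps rat) : fcoef f 0 = 1 ->
  f * fps_eulerD (fps_log f) = fps_eulerD f.
Proof.
move=> f0; set u := 1 - f; have u0 : fcoef u 0 = 0 by rewrite fcoefB f0 subrr.
have fE : f = 1 - u by rewrite /u opprB addrC subrK.
pose L N : fps rat := \sum_(1 <= k < N.+1) k%:R^-1 *: u ^+ k.
have logE N i : (i <= N)%N -> fcoef (fps_log f) i = - fcoef (L N) i.
  move=> iN; rewrite fcoef_fps_log // /L fcoef_sum.
  rewrite [in RHS](@big_cat_nat _ _ _ i.+1) //=.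
  rewrite [X in - (_ + X)]big1_seq ?addr0 // => k.
  rewrite mem_index_iota => /andP[_ /andP[ik _]].
  by rewrite fcoef_expr_small ?mulr0.
have thetaL N : fps_eulerD (L N) = (\sum_(i < N) u ^+ i) * fps_eulerD u.
  rewrite fps_eulerD_sum big_add1 /= big_mkord mulr_suml; apply: eq_bigr => i _.
  by rewrite fps_eulerDZ fps_eulerDX scalerA mulVf ?scale1r // Num.Theory.pnatr_eq0.
apply/fpsP => n.
(* Order n + 1: then u ^+ n.+1 contributes nothing up to degree n. *)
have -> : fcoef (f * fps_eulerD (fps_log f)) n
        = - fcoef (f * fps_eulerD (L n.+1)) n.
  rewrite !fcoefM -sumrN; apply: eq_bigr => i _.
  by rewrite !fcoef_eulerD (@logE n.+1) ?mulrN // (leq_trans (leq_subr _ _)).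
rewrite thetaL mulrA {1}fE -opprB mulNr -subrX1 opprB mulrBl mul1r.
rewrite fcoefB [X in _ - X]fcoefM big1 ?subr0 => [|i _]; last first.
  by rewrite fcoef_expr_small ?mul0r.
by rewrite -fcoefN /u -fps_eulerDN opprB fps_eulerDD fps_eulerDN fps_eulerD1 subr0.
Qed.

(** The recurrence expresses coefficient n at index a.+1 through coefficient n
    at index a and coefficient n.-1 at a larger index: hence an induction on n,
    then on a. *)
Lemma pascal_rec_uniq {R : comNzRingType} (r : nat) (F G : nat -> fps R) :
    (forall a, F a.+1 = F a + fpsX * F (a + r)%N) ->
    (forall a, G a.+1 = G a + fpsX * G (a + r)%N) ->
  F 0%N = G 0%N -> forall a, F a = G a.
Proof.
move=> recF recG FG0 a; apply/fpsP => n; elim: n a => [|n IHn].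
  by elim=> [|a IHa]; rewrite ?FG0 // recF recG !fcoefD !fcoefXM IHa.
by elim=> [|a IHa]; rewrite ?FG0 // recF recG !fcoefD !fcoefXM IHa IHn.
Qed.

Definition bin_series (r a : nat) : fps rat := Fps (fun n => 'C(a + r * n, n)%:R).

(** The power [binomial_series r ^+ a]: for n > 0,
    C(a+rn, n) - r C(a+rn-1, n-1) = a/(a+rn) C(a+rn, n).  The difference form
    has no division by zero at a = n = 0 and inherits the recurrence from [bin_series]. *)
Definition binomial_series_pow (r a : nat) : fps rat :=
  bin_series r a - r%:R *: (fpsX * bin_series r (a + r.-1)).

Section Rothe.
Variable r : nat.
Hypothesis r_gt0 : (0 < r)%N.

Lemma bin_series_rec a :
  bin_series r a.+1 = bin_series r a + fpsX * bin_series r (a + r).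
Proof.
apply/fpsP => -[|n]; rewrite fcoefD fcoefXM /= ?bin0 ?addr0 //.
by rewrite addSn binS natrD mulnS addnA.
Qed.

Lemma binomial_series_pow_rec a :
  binomial_series_pow r a.+1
  = binomial_series_pow r a + fpsX * binomial_series_pow r (a + r).
Proof.
rewrite /binomial_series_pow addSn !bin_series_rec (addnAC a r.-1 r).
by rewrite !mulrDr scalerDr mulrN -scalerAr opprD addrACA.
Qed.

Lemma fcoef_binomial_series_pow a n :
  (a + r * n)%:R * fcoef (binomial_series_pow r a) n
  = a%:R * fcoef (bin_series r a) n.
Proof.
rewrite fcoefB fcoefZ fcoefXM /=; case: n => [|n].
  by rewrite muln0 addn0 mulr0 subr0.
have rS : (a + r * n.+1 = (a + r.-1 + r * n).+1)%N.
  by rewrite mulnS addnA -{1}(prednK r_gt0) addnS addSn.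
have absorb : ((a + r * n.+1) * 'C(a + r.-1 + r * n, n)
              = n.+1 * 'C(a + r * n.+1, n.+1))%N.
  by rewrite rS mul_bin_diag.
rewrite mulrBr mulrCA -[X in _ - _ * X]natrM absorb natrM natrD natrM.
by rewrite mulrA mulrDl addrK.
Qed.

Lemma binomial_series_pow0 : binomial_series_pow r 0 = 1.
Proof.
apply/fpsP => -[|n]; first by rewrite fcoefB fcoefZ fcoefXM /= bin0 mulr0 subr0.
have /eqP := fcoef_binomial_series_pow 0 n.+1; rewrite mul0r mulf_eq0.
by rewrite Num.Theory.pnatr_eq0 add0n muln_eq0 (gtn_eqF r_gt0) /= => /eqP.
Qed.

Lemma binomial_series_pow1 : binomial_series_pow r 1 = binomial_series r.
Proof.
apply/fpsP => n; rewrite fcoef_fps_sumX addnC.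
have nz : (1 + r * n)%:R != 0 :> rat by rewrite Num.Theory.pnatr_eq0.
apply: (mulfI nz); rewrite fcoef_binomial_series_pow /= mul1r.
by rewrite mulrC divfK.
Qed.

(** The Rothe-Hagen convolution. *)
Lemma binomial_series_pow_conv a :
  binomial_series_pow r a * bin_series r 0 = bin_series r a.
Proof.
move: a; apply: (@pascal_rec_uniq _ r) => [a|a|].
- by rewrite binomial_series_pow_rec mulrDl mulrA.
- exact: bin_series_rec.
- by rewrite binomial_series_pow0 mul1r.
Qed.

Lemma binomial_series_eulerD :
  binomial_series r + r%:R *: fps_eulerD (binomial_series r) = bin_series r 1.
Proof.
rewrite -binomial_series_pow1; apply/fpsP => n.
have := fcoef_binomial_series_pow 1 n; rewrite mul1r => <-.
by rewrite fcoefD fcoefZ /= mulrA natrD natrM mulrDl mul1r.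
Qed.

End Rothe.

Theorem theorem1 (r : nat) (hr : (0 < r)%N) :
  \fsum_(1 <= k) (('C(r * k, k)%:R / k%:R) *: fpsX ^+ k)
  = r%:R * fps_log (binomial_series r) :> fps rat.
Proof.
set B := binomial_series r; have B0 := binomial_series_coef0 r.
rewrite mulr_natl -scaler_nat.
have key : r%:R *: fps_eulerD (fps_log B) = bin_series r 0 - 1.
  apply: (@fps_mulI _ B) => //; rewrite -scalerAr fps_eulerD_log // mulrBr mulr1.
  rewrite /B -{2}binomial_series_pow1 // binomial_series_pow_conv //.
  by rewrite -binomial_series_eulerD // addrC addKr.
apply/fpsP => -[|n]; rewrite fcoef_fps_sumX.
  by rewrite fcoefZ fcoef_fps_log // big_geq ?oppr0 ?mulr0.
have nz : n.+1%:R != 0 :> rat by rewrite Num.Theory.pnatr_eq0.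
apply: (mulfI nz); rewrite mulrC divfK // -fcoefZ.
move/(congr1 (fun s => fcoef s n.+1)): key.
by rewrite -fps_eulerDZ fcoefB fcoef1 subr0 /= add0n.
Qed.
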